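(* Let $R$ be a unital exchange ring. The following conditions are equivalent: (i) $R$ is a $QB$-ring; (ii) every element of $R^r$ extends to an element of $R_q^{-1}$, i.e. for every $a\in R^r$ there is $u\in R_q^{-1}$ with $a\le u$; (iii) for every $x\in R^r$ there is $v\in R_q^{-1}$ such that $x=xvx$.
   Context: Rings are associative. A unital ring $R$ is an exchange ring if for every $a\in R$ there is an idempotent $p\in aR$ such that $1-p\in(1-a)R$. For $s,t\in R$ write $s\perp t$ if $sRt=0=tRs$. $u\in R$ is quasi-invertible, $u\in R_q^{-1}$, if there exist $c,d\in R$ with $(1-uc)\perp(1-du)$; such elements are von Neumann regular. A unital ring $R$ is a $QB$-ring if for all $a,b,x\in R$ with $xa+b=1$ there is $y\in R$ with $a+yb\in R_q^{-1}$. $R^r$ is the set of von Neumann regular elements, i.e. those $a\in R$ with $a=axa$ for some $x\in R$. For $a,b\in R^r$, $a\le b$ ($b$ extends $a$) means that there is $x\in R$ with $a=axb=bxa=axa$. *)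

(* Defs.v *)
From HB Require Import structures.
From mathcomp Require Import all_boot all_algebra.
Set Implicit Arguments.
Unset Strict Implicit.
Unset Printing Implicit Defensive.
Import GRing.Theory.
Local Open Scope ring_scope.

(* Unital rings are [pzRingType]s, so that the zero ring is not excluded. *)

Definition exchange_ring (R : pzRingType) : Prop :=
  forall a : R, exists p : R,
    [/\ p * p = p,
        exists r : R, p = a * r
      & exists s : R, 1 - p = (1 - a) * s].

Definition ring_perp (R : pzRingType) (s t : R) : Prop :=
  forall r : R, s * r * t = 0 /\ t * r * s = 0.

Definition quasi_invertible (R : pzRingType) (u : R) : Prop :=
  exists c d : R, ring_perp (1 - u * c) (1 - d * u).

Definition QB_ring (R : pzRingType) : Prop :=
  forall a b x : R, x * a + b = 1 ->
    exists y : R, quasi_invertible (a + y * b).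

Definition vn_regular (R : pzRingType) (a : R) : Prop :=
  exists x : R, a = a * x * a.

Definition vn_le (R : pzRingType) (a b : R) : Prop :=
  [/\ vn_regular a, vn_regular b
    & exists x : R, [/\ a = a * x * b, a = b * x * a & a = a * x * a]].

(* Main.v *)
Require Import Defs.
From HB Require Import structures.
From mathcomp Require Import all_boot all_algebra.
Set Implicit Arguments.
Unset Strict Implicit.
Unset Printing Implicit Defensive.
Import GRing.Theory.
Local Open Scope ring_scope.

(* For an idempotent [p] in [aR] with [1 - p] in [(1 - ax)R], the element [pa] *)
(* is regular. If [v] is a quasi-invertible inner inverse of [pa], then some   *)
(* inner inverse of [v], multiplied by units on both sides, has the form       *)
(* [a + (1 - ax) y] (the opposite-ring version of the QB-condition). This can  *)
(* be moved to the other side: [a + (1 - ax) y] and [-(a + y (1 - xa))] are    *)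
(* complementary corners of two mutually inverse 2x2 matrices, so that one is  *)
(* quasi-invertible as soon as the other is. Conversely, in a QB-ring, if      *)
(* [a = axa], [x = xax] and [a + y (1 - xa)] is quasi-invertible, multiplying  *)
(* it by a unit gives the extension [a + (1 - ax) y (1 - xa)] of [a].          *)

Section QuasiInvertible.
Variable R : pzRingType.
Implicit Types a b c d e f g h p s t u v x y : R.

Lemma ring_perpC s t : ring_perp s t -> ring_perp t s.
Proof. by move=> st r; have [] := st r. Qed.

Lemma ring_perp_mul a b c d s t :
  ring_perp s t -> ring_perp (a * s * b) (c * t * d).
Proof.
move=> st r; have [st0 _] := st (b * r * c); have [_ ts0] := st (d * r * a).
split.
- have -> : a * s * b * r * (c * t * d) = a * (s * (b * r * c) * t) * d.
    by rewrite !mulrA.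
  by rewrite st0 mulr0 mul0r.
- have -> : c * t * d * r * (a * s * b) = c * (t * (d * r * a) * s) * b.
    by rewrite !mulrA.
  by rewrite ts0 mulr0 mul0r.
Qed.

Lemma mulr_1B_comm a b : (1 - a * b) * a = a * (1 - b * a).
Proof. by rewrite mulrBl mulrBr mul1r mulr1 mulrA. Qed.

(** Taking [v = c + d - c * u * d] factors [1 - u * v] and [1 - v * u] through the given orthogonal
    pair, so [u] serves as both witnesses for [v]. *)
Lemma quasi_invertible_inner u :
  quasi_invertible u -> exists v, quasi_invertible v /\ u * v * u = u.
Proof.
move=> [c [d cd]]; pose v := c + (1 - c * u) * d.
have uv : 1 - u * v = 1 * (1 - u * c) * (1 - u * d).
  by rewrite mul1r /v mulrDr opprD addrA [RHS]mulrBr mulr1 !mulrA mulr_1B_comm.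
have vu : 1 - v * u = (1 - c * u) * (1 - d * u) * 1.
  by rewrite mulr1 /v mulrDl opprD addrA [RHS]mulrBr mulr1 mulrA.
exists v; split.
  by exists u, u; apply: ring_perpC; rewrite uv vu; apply: ring_perp_mul.
apply/esym/eqP; rewrite -subr_eq0 -{1}[u]mul1r -mulrBl uv mul1r -mulrA.
by rewrite mulr_1B_comm mulrA; have [-> _] := cd u.
Qed.

Lemma quasi_invertible_unit_mul g g' h h' u :
    g * g' = 1 -> g' * g = 1 -> h * h' = 1 -> h' * h = 1 ->
  quasi_invertible u -> quasi_invertible (g * u * h).
Proof.
move=> gg' g'g hh' h'h [c [d cd]].
exists (h' * c * g'), (h' * d * g').
have -> : 1 - g * u * h * (h' * c * g') = g * (1 - u * c) * g'.
  rewrite mulrBr mulr1 mulrBl gg'; congr (_ - _).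
  by rewrite -!mulrA (mulrA h) hh' mul1r.
have -> : 1 - h' * d * g' * (g * u * h) = h' * (1 - d * u) * h.
  rewrite mulrBr mulr1 mulrBl h'h; congr (_ - _).
  by rewrite -!mulrA (mulrA g') g'g mul1r.
exact: ring_perp_mul.
Qed.

(** The hypotheses make [e], [f] idempotents generating the same right ideal; then [e - f] squares
    to zero. *)
Lemma idempotent_exchange_unit e f :
  e * f = f -> f * e = e -> (e + 1 - f) * (f + 1 - e) = 1.
Proof.
move=> ef fe.
have ee : e * e = e by rewrite -{2}fe mulrA ef fe.
have ff : f * f = f by rewrite -{2}ef mulrA fe ef.
rewrite mulrBr mulrDr mulr1 !mulrBl !mulrDl !mul1r ef ff ee fe !addrK.
by rewrite addrCA subrr addr0 addrAC subrr add0r.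
Qed.

Lemma square_zero_unit t : t * t = 0 -> (1 + t) * (1 - t) = 1.
Proof. by move=> tt; rewrite mulrBr mulr1 mulrDl mul1r tt addr0 addrK. Qed.

(* With [u = a + (1 - ax) y] and [w = a + y (1 - xa)], the matrices            *)
(* [[u, 1 - ax], [1 - xy, -x]] and [[x, 1 - xa], [1 - yx, -w]] are mutually    *)
(* inverse; the witnesses for [w] are Schur complements.                       *)
Lemma quasi_invertible_transfer a x y :
  quasi_invertible (a + (1 - a * x) * y) ->
  quasi_invertible (a + y * (1 - x * a)).
Proof.
set u := a + _; set w := a + _; move=> [c [d cd]].
have xw : 1 - x * w = (1 - x * y) * (1 - x * a).
  by rewrite mulrDr opprD addrA mulrA [RHS]mulrBl mul1r.
have wx : 1 - w * x = (1 - y * x) * (1 - a * x).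
  by rewrite mulrDl opprD addrA -mulrA mulr_1B_comm mulrA [RHS]mulrBl mul1r.
have axw : (1 - a * x) * w = u * (1 - x * a).
  by rewrite mulrDr mulr_1B_comm [RHS]mulrDl mulrA.
have wxy : w * (1 - x * y) = (1 - y * x) * u.
  rewrite [RHS]mulrDr mulrA -wx !mulrBl mulrBr !mul1r mulr1 mulrA addrA.
  by rewrite /w mulrBr mulr1 mulrA addrA addrAC.
exists (x + (1 - x * y) * c * (1 - a * x)), (x + (1 - x * y) * d * (1 - a * x)).
have -> : 1 - w * (x + (1 - x * y) * c * (1 - a * x)) =
          (1 - y * x) * (1 - u * c) * (1 - a * x).
  rewrite mulrDr opprD addrA wx !mulrA wxy -mulrBl; congr (_ * _).
  by rewrite [RHS]mulrBr mulr1 mulrA.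
have -> : 1 - (x + (1 - x * y) * d * (1 - a * x)) * w =
          (1 - x * y) * (1 - d * u) * (1 - x * a).
  rewrite mulrDl opprD addrA xw -!mulrA axw -mulrBr; congr (_ * _).
  by rewrite [RHS]mulrBl mul1r !mulrA.
exact: ring_perp_mul.
Qed.

End QuasiInvertible.

Theorem theorem8p4 (R : pzRingType) (exR : exchange_ring R) :
  [<-> QB_ring R;
       forall a : R, vn_regular a ->
         exists u : R, quasi_invertible u /\ vn_le a u;
       forall x : R, vn_regular x ->
         exists v : R, quasi_invertible v /\ x = x * v * x].
Proof.
tfae.
- move=> QB a [x0 ax0a]; pose x := x0 * a * x0.
  have axa : a * x * a = a by rewrite /x !mulrA -!ax0a.
  have xax : x * a * x = x.
    have ax0aK z : a * (x0 * (a * z)) = a * z by rewrite !mulrA -ax0a.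
    by rewrite /x -!mulrA !ax0aK.
  have [y qi_u] := QB a (1 - x * a) x (subrKC _ _).
  set u := a + _ in qi_u.
  have uxa : u * (x * a) = a.
    rewrite mulrDl mulrA axa -mulrA mulrBl mul1r (mulrA (x * a)) xax subrr.
    by rewrite mulr0 addr0.
  clearbody u.
  have ef : x * a * (x * u) = x * u by rewrite mulrA xax.
  have fe : x * u * (x * a) = x * a by rewrite -mulrA uxa.
  (* This unit turns the idempotent [x * u] into [x * a], while [u * h] still agrees with [a] on
     [x * a]. *)
  pose h := x * a + 1 - x * u.
  have qi_uh : quasi_invertible (1 * u * h).
    apply: (quasi_invertible_unit_mul (mulr1 1) (mulr1 1) _ _ qi_u).
    - exact: idempotent_exchange_unit ef fe.
    - exact: idempotent_exchange_unit fe ef.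
  rewrite mul1r in qi_uh.
  have xuh : x * (u * h) = x * a.
    have ff : x * u * (x * u) = x * u by rewrite -{2}ef mulrA fe ef.
    by rewrite mulrA /h mulrBr mulrDr mulr1 fe ff addrK.
  have uhxa : u * h * (x * a) = a.
    by rewrite -mulrA /h mulrBl mulrDl mul1r fe (mulrA (x * a) x a) xax addrK.
  have [v [_ uhv]] := quasi_invertible_inner qi_uh.
  exists (u * h); split=> //; split.
  - by exists x.
  - by exists v.
  - by exists x; rewrite -mulrA xuh mulrA axa -mulrA uhxa.
- move=> ext a /ext[u [/quasi_invertible_inner[v [qi_v uvu]] [_ _]]].
  move=> [x [axu uxa axa]]; exists v; split=> //.
  (* [a] factors through [u] on either side, so an inner inverse of [u] is one of [a]. *)
  have -> : a * v * a = a * x * u * v * (u * x * a) by rewrite -axu -uxa.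
  have -> : a * x * u * v * (u * x * a) = a * x * (u * v * u) * x * a.
    by rewrite !mulrA.
  by rewrite uvu -axu.
- move=> inner a b x xab.
  have [p [pp [r pE] [s qE]]] := exR (a * x).
  have [t tE] : exists t, t = p * a by exists (p * a).
  have pt : p * t = t by rewrite tE mulrA pp.
  have txr : t * (x * r) = p by rewrite tE -!mulrA (mulrA a) -pE.
  have [v [qi_v tvt]] : exists v, quasi_invertible v /\ t = t * v * t.
    by apply: inner; exists (x * r); rewrite txr.
  have [w [qi_w vwv]] := quasi_invertible_inner qi_v.
  (* The correction [n] is chosen so that [z = w * (1 + n)] satisfies [t * v * z = t], which [w]
     alone need not do. *)
  pose n := v * t * (1 - v * w).
  have nn : n * n = 0.
    by rewrite /n -!mulrA (mulrA _ v) mulrBl mul1r vwv subrr mul0r !mulr0.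
  have fp : t * v * p = p by rewrite -txr mulrA -tvt.
  have pf : p * (t * v) = t * v by rewrite mulrA pt.
  pose z := w * (1 + n).
  have fz : t * v * z = t.
    have vwn : v * w * n = n by rewrite /n !mulrA vwv.
    have tn : t * n = t * (1 - v * w) by rewrite /n !mulrA -tvt.
    rewrite /z -mulrA (mulrA v) mulrDr mulr1 vwn mulrDr tn mulrBr mulr1.
    exact: subrKC.
  have qi : quasi_invertible ((t * v + 1 - p) * w * (1 + n)).
    apply: quasi_invertible_unit_mul qi_w.
    - exact: idempotent_exchange_unit fp pf.
    - exact: idempotent_exchange_unit pf fp.
    - exact: square_zero_unit.
    - by rewrite -{2}[n]opprK square_zero_unit // mulrNN.
  have -> : b = 1 - x * a by rewrite -xab addrC addKr.
  (* As [(1 - a * x) * s = 1 - p], this choice gives [p * a + (1 - p) * z], which is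
     [(t * v + 1 - p) * z]. *)
  exists (s * (z - a)); apply: quasi_invertible_transfer.
  suff -> : a + (1 - a * x) * (s * (z - a)) = (t * v + 1 - p) * w * (1 + n).
    exact: qi.
  rewrite mulrA -qE -[RHS]mulrA -/z -addrA [RHS]mulrDl fz mulrBr addrCA addrC.
  by congr (_ + _); rewrite tE mulrBl mul1r opprB addrC subrK.
Qed.
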